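(* Let $G$ and $M$ be positive definite $2r\times2r$ matrices whose spectra lie in a fixed compact subset $S$ of $(0,\infty)$. Suppose that $M=\operatorname{diag}(aI_r,bI_r)$ with $a,b>0$, and let $$K=\begin{pmatrix}0&\Theta\\\Theta&0\end{pmatrix}$$ with $\Theta\ge0$ a diagonal $r\times r$ matrix. Then $$\|G^{1/2}KG^{1/2}-M^{1/2}KM^{1/2}\|_{\mathrm{op}}\le C\big(\|(G-M)K\|_{\mathrm{op}}+\|K(G-M)\|_{\mathrm{op}}\big),$$ where $C$ depends only on the spectral bounds for $G$ and $M$ (i.e. only on $S$; in particular not on $r$ or $\Theta$).
   Context: Matrices are real or complex; positive definite matrices are Hermitian; $\|\cdot\|_{\mathrm{op}}$ is the operator norm and $A^{1/2}$ the positive definite square root. *)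

(* Defs.v *)
From HB Require Import structures.
From mathcomp Require Import all_boot all_order all_algebra.
From mathcomp Require Import sesquilinear spectral.
From mathcomp Require Import boolp classical_sets reals topology normedtype.
From mathcomp Require Import complex.

Set Implicit Arguments.
Unset Strict Implicit.
Unset Printing Implicit Defensive.

Import Order.TTheory GRing.Theory Num.Theory.
Import numFieldNormedType.Exports.

Local Open Scope classical_set_scope.
Local Open Scope ring_scope.
Local Open Scope sesquilinear_scope.
Local Open Scope complex_scope.

(* Matrices have entries in R[i]; a real matrix is one whose entries lie in R.
   On R[i], 0 <= z (resp. 0 < z) says that z is real and nonnegative (resp.
   positive). *)

Definition qform (R : realType) (n : nat) (A : 'M[R[i]]_n) (x : 'cV[R[i]]_n) :
    R[i] :=
  (x ^t* *m A *m x) 0 0.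

Definition psdmx (R : realType) (n : nat) (A : 'M[R[i]]_n) : Prop :=
  A \is hermsymmx /\ forall x : 'cV[R[i]]_n, 0 <= qform A x.

Definition pdmx (R : realType) (n : nat) (A : 'M[R[i]]_n) : Prop :=
  A \is hermsymmx /\ forall x : 'cV[R[i]]_n, x != 0 -> 0 < qform A x.

(* For positive definite A, the set below is a singleton. *)
Definition sqrtmx (R : realType) (n : nat) (A : 'M[R[i]]_n) : 'M[R[i]]_n :=
  xget 0 [set B : 'M[R[i]]_n | pdmx B /\ B *m B = A].

Definition l2norm (R : realType) (n : nat) (x : 'cV[R[i]]_n) : R :=
  Num.sqrt (\sum_(i < n) Normc.normc (x i 0) ^+ 2).

(* The default norm on matrices in MathComp-Analysis is the maximum norm of the
   entries; this is the norm induced by the Euclidean one. *)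
Definition opnorm (R : realType) (m n : nat) (A : 'M[R[i]]_(m, n)) : R :=
  sup [set l2norm (A *m x) | x in [set x : 'cV[R[i]]_n | l2norm x <= 1]].

Definition spectrum_in (R : realType) (n : nat) (A : 'M[R[i]]_n) (S : set R) :
    Prop :=
  forall z : R[i], eigenvalue A z -> exists2 s : R, S s & z = s%:C.

(* Main.v *)
Require Import Defs.
From HB Require Import structures.
From mathcomp Require Import all_boot all_order all_algebra.
From mathcomp Require Import sesquilinear spectral.
From mathcomp Require Import boolp classical_sets reals topology normedtype.
From mathcomp Require Import derive complex ring.

Set Implicit Arguments.
Unset Strict Implicit.
Unset Printing Implicit Defensive.

Import Order.TTheory GRing.Theory Num.Theory.
Import numFieldNormedType.Exports.

Local Open Scope classical_set_scope.
Local Open Scope ring_scope.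
Local Open Scope sesquilinear_scope.
Local Open Scope complex_scope.

(** Write P and Q for the positive definite square roots of G and M, and
    D = P - Q.  Since P K P - Q K Q = D K P + Q (K D), and P and Q have norm
    at most the square root of the largest point of S, it suffices to bound
    D K and K D.  As D and K are Hermitian, K D is the adjoint of D K and has
    the same norm ([opnorm_adjmx]); only D K matters.

    The difference of the square roots solves the Sylvester equation
    P D + D Q = P P - Q Q = G - M.  Multiply it by K on the right.  Because K
    exchanges the two blocks and M is scalar on each of them, Q K = K Q' where
    Q' is Q with its two scalars swapped, so that X = D K solves
    P X + X Q' = (G - M) K: the unknown is again D K, and no inverse of K
    appears.  Restricted to a block on which Q' is the scalar v >= 0, this
    equation reads (P + v) X = (G - M) K, and P + v is bounded below by the
    square root of the smallest point m of S ([l2norm_shift_ge]), because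
    |(P + v) x| ^ 2 = <G x, x> + 2 v <P x, x> + v ^ 2 |x| ^ 2 >= m |x| ^ 2.
    Adding the two blocks gives |D K| <= 2 / sqrt m * |(G - M) K|
    ([opnorm_sylvester]), with a constant that sees neither r nor Theta.

    The square roots are obtained from the spectral theorem, as are the bounds
    on the quadratic form of G.  That the square root of M is the expected
    block scalar matrix is the same Sylvester estimate with zero right-hand
    side ([pd_sqrt_block_scalar]). *)

(** * Adjoints and Hermitian matrices *)

Section Adjoint.
Context {R : realType}.
Local Notation C := R[i].

Lemma adjmxM (m n p : nat) (A : 'M[C]_(m, n)) (B : 'M[C]_(n, p)) :
  (A *m B)^t* = B^t* *m A^t*.
Proof. by rewrite trmx_mul map_mxM. Qed.

Lemma adjmxD (m n : nat) (A B : 'M[C]_(m, n)) : (A + B)^t* = A^t* + B^t*.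
Proof. by rewrite linearD map_mxD. Qed.

Lemma adjmxB (m n : nat) (A B : 'M[C]_(m, n)) : (A - B)^t* = A^t* - B^t*.
Proof. by rewrite linearB map_mxB. Qed.

Lemma adjmxZ (m n : nat) (c : C) (A : 'M[C]_(m, n)) :
  (c *: A)^t* = c^*%R *: A^t*.
Proof. by rewrite linearZ map_mxZ. Qed.

Lemma conj_realc (t : R) : (t%:C : C)^*%R = t%:C.
Proof. by apply/CrealP/complex_realP; exists t. Qed.

Lemma hermsymP (n : nat) (A : 'M[C]_n) :
  reflect (A^t* = A) (A \is hermsymmx).
Proof.
by apply: (iffP (is_hermitianmxP _ _ _)); rewrite expr0 scale1r => /esym.
Qed.

End Adjoint.

(** * The Euclidean norm *)

Section Euclidean.
Context {R : realType}.
Local Notation C := R[i].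

Lemma normc_ge0 (z : C) : 0 <= Normc.normc z.
Proof. by case: z => a b; exact: sqrtr_ge0. Qed.

Lemma l2norm_ge0 (n : nat) (x : 'cV[C]_n) : 0 <= l2norm x.
Proof. exact: sqrtr_ge0. Qed.

Lemma l2norm_sqr (n : nat) (x : 'cV[C]_n) :
  l2norm x ^+ 2 = \sum_i Normc.normc (x i 0) ^+ 2.
Proof. by rewrite sqr_sqrtr// sumr_ge0// => i _; rewrite sqr_ge0. Qed.

Lemma sqr_normcE (z : C) : (Normc.normc z ^+ 2)%:C = z * z^*%R.
Proof. by rewrite -normCK rmorphXn. Qed.

Lemma l2norm_sqrE (n : nat) (x : 'cV[C]_n) :
  (l2norm x ^+ 2)%:C = (x^t* *m x) 0 0.
Proof.
rewrite l2norm_sqr mxE rmorph_sum; apply: eq_bigr => i _ /=.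
by rewrite !mxE sqr_normcE mulrC.
Qed.

(** This brings over the triangle and Cauchy-Schwarz inequalities from the
    standard sesquilinear form on row vectors. *)
Lemma l2norm_dot (n : nat) (x : 'cV[C]_n) :
  (l2norm x)%:C = sqrtC (dotmx x^T x^T).
Proof.
rewrite dotmxE -[LHS](@sqrCK C) ?ler0c ?l2norm_ge0// -rmorphXn /=.
congr sqrtC; rewrite l2norm_sqrE !mxE.
by apply: eq_bigr => i _; rewrite !mxE mulrC.
Qed.

Lemma l2normD (n : nat) (x y : 'cV[C]_n) :
  l2norm (x + y) <= l2norm x + l2norm y.
Proof.
rewrite -lecR rmorphD /= !l2norm_dot linearD /=.
by case: (triangle_lerif (@dotmx C n) x^T y^T).
Qed.

Lemma l2norm_CauchySchwarz (n : nat) (x y : 'cV[C]_n) :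
  `|(x^t* *m y) 0 0| <= (l2norm x * l2norm y)%:C.
Proof.
have <- : dotmx y^T x^T = (x^t* *m y) 0 0.
  by rewrite dotmxE !mxE; apply: eq_bigr => i _; rewrite !mxE mulrC.
rewrite mulrC rmorphM /= !l2norm_dot.
by case: (CauchySchwarz_sqrt (@dotmx C n) y^T x^T).
Qed.

Lemma l2normZ (n : nat) (c : C) (x : 'cV[C]_n) :
  l2norm (c *: x) = Normc.normc c * l2norm x.
Proof.
rewrite /l2norm -[X in X * _]ger0_norm; last exact: normc_ge0.
rewrite -sqrtr_sqr -sqrtrM ?sqr_ge0//; congr Num.sqrt.
rewrite mulr_sumr; apply: eq_bigr => i _.
by rewrite mxE Normc.normcM exprMn.
Qed.

Lemma l2norm0_eq0 (n : nat) (x : 'cV[C]_n) : l2norm x <= 0 -> x = 0.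
Proof.
move=> x0; have {}x0 : l2norm x ^+ 2 = 0.
  by apply/eqP; rewrite sqrf_eq0 eq_le x0 l2norm_ge0.
apply/colP => i; rewrite mxE; apply: Normc.eq0_normc; apply/eqP.
move/eqP: x0; rewrite l2norm_sqr psumr_eq0 => [|j _]; last exact: sqr_ge0.
by move=> /allP/(_ i); rewrite mem_index_enum sqrf_eq0 => /(_ isT).
Qed.

Lemma l2norm0 (n : nat) : l2norm (0 : 'cV[C]_n) = 0.
Proof. by rewrite -(scale0r 0) l2normZ Normc.normc0 mul0r. Qed.

Lemma normc_le_l2norm (n : nat) (x : 'cV[C]_n) (i : 'I_n) :
  Normc.normc (x i 0) <= l2norm x.
Proof.
rewrite -(@ler_pXn2r _ 2)// ?nnegrE ?l2norm_ge0 ?normc_ge0//.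
rewrite l2norm_sqr (bigD1 i)//= lerDl sumr_ge0// => j _.
exact: sqr_ge0.
Qed.

Lemma l2norm_usub (m n : nat) (x : 'cV[C]_(m + n)) :
  l2norm (col_mx (usubmx x) 0 : 'cV_(m + n)) <= l2norm x.
Proof.
rewrite -(@ler_pXn2r _ 2)// ?nnegrE ?l2norm_ge0// !l2norm_sqr.
apply: ler_sum => i _; rewrite mxE; case: splitP => j ij.
  by rewrite mxE (_ : lshift n j = i)//; apply: val_inj.
by rewrite mxE Normc.normc0 expr0n sqr_ge0.
Qed.

Lemma l2norm_dsub (m n : nat) (x : 'cV[C]_(m + n)) :
  l2norm (col_mx 0 (dsubmx x) : 'cV_(m + n)) <= l2norm x.
Proof.
rewrite -(@ler_pXn2r _ 2)// ?nnegrE ?l2norm_ge0// !l2norm_sqr.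
apply: ler_sum => i _; rewrite mxE; case: splitP => j ij; last first.
  by rewrite mxE (_ : rshift m j = i)//; apply: val_inj.
by rewrite mxE Normc.normc0 expr0n sqr_ge0.
Qed.

End Euclidean.

(** * The operator norm *)

Section OperatorNorm.
Context {R : realType}.
Local Notation C := R[i].

(** A supremum in the reals is meaningful only for a nonempty bounded set; a
    crude bound by the norms of the columns is enough for that. *)
Lemma mulmx_bounded (m n : nat) (A : 'M[C]_(m, n)) :
  exists2 c : R, 0 <= c & forall x, l2norm (A *m x) <= c * l2norm x.
Proof.
exists (\sum_j l2norm (col j A)).
  by apply: sumr_ge0 => j _; exact: l2norm_ge0.
move=> x; have -> : A *m x = \sum_j x j 0 *: col j A.
  apply/colP => i; rewrite mxE summxE; apply: eq_bigr => j _.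
  by rewrite !mxE mulrC.
rewrite mulr_suml.
elim/big_rec2: _ => [|j c y _ yc]; first by rewrite l2norm0.
apply: (le_trans (l2normD _ _)); apply: lerD yc.
by rewrite l2normZ mulrC ler_wpM2l ?l2norm_ge0// normc_le_l2norm.
Qed.

Let opnorm_has_sup (m n : nat) (A : 'M[C]_(m, n)) :
  has_sup [set l2norm (A *m x) | x in [set x : 'cV[C]_n | l2norm x <= 1]].
Proof.
split; first by exists (l2norm (A *m 0)), 0; rewrite //= l2norm0.
have [c c0 Ac] := mulmx_bounded A.
exists c => _ [x /= x1 <-]; apply: (le_trans (Ac x)).
by rewrite ler_piMr.
Qed.

Lemma opnorm_ge0 (m n : nat) (A : 'M[C]_(m, n)) : 0 <= opnorm A.
Proof.
apply: le_trans (l2norm_ge0 (A *m 0)) _.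
apply: sup_upper_bound; first exact: opnorm_has_sup.
by exists 0; rewrite //= l2norm0.
Qed.

Lemma le_opnorm (m n : nat) (A : 'M[C]_(m, n)) (x : 'cV[C]_n) :
  l2norm (A *m x) <= opnorm A * l2norm x.
Proof.
have [x0|x0] := leP (l2norm x) 0.
  by rewrite (l2norm0_eq0 x0) mulmx0 !l2norm0 mulr0.
rewrite -ler_pdivrMr//.
have nE : Normc.normc ((l2norm x)^-1)%:C = (l2norm x)^-1.
  by rewrite /= expr0n addr0 sqrtr_sqr ger0_norm// invr_ge0 l2norm_ge0.
have -> : l2norm (A *m x) / l2norm x = l2norm (A *m (((l2norm x)^-1)%:C *: x)).
  by rewrite -scalemxAr l2normZ nE mulrC.
apply: sup_upper_bound; first exact: opnorm_has_sup.
exists (((l2norm x)^-1)%:C *: x) => //=.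
by rewrite l2normZ nE mulVf// gt_eqF.
Qed.

Lemma opnorm_le (m n : nat) (A : 'M[C]_(m, n)) (c : R) : 0 <= c ->
  (forall x, l2norm (A *m x) <= c * l2norm x) -> opnorm A <= c.
Proof.
move=> c0 Ac; apply: ge_sup; first by case: (opnorm_has_sup A).
move=> _ [x /= x1 <-]; apply: (le_trans (Ac x)).
by rewrite ler_piMr.
Qed.

Lemma opnorm_le0 (m n : nat) (A : 'M[C]_(m, n)) : opnorm A <= 0 -> A = 0.
Proof.
move=> A0; apply/matrixP => i j; rewrite [RHS]mxE.
have : A *m delta_mx j (0 : 'I_1) = 0.
  apply: l2norm0_eq0; apply: (le_trans (le_opnorm _ _)).
  by rewrite mulr_le0_ge0 ?l2norm_ge0.
by rewrite -colE => /matrixP/(_ i 0); rewrite !mxE.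
Qed.

Lemma opnorm0 (m n : nat) : opnorm (0 : 'M[C]_(m, n)) = 0.
Proof.
apply/eqP; rewrite eq_le opnorm_ge0 andbT; apply: opnorm_le => // x.
by rewrite mul0mx l2norm0 mul0r.
Qed.

Lemma opnormD (m n : nat) (A B : 'M[C]_(m, n)) :
  opnorm (A + B) <= opnorm A + opnorm B.
Proof.
apply: opnorm_le => [|x]; first by rewrite addr_ge0 ?opnorm_ge0.
rewrite mulmxDl mulrDl; apply: (le_trans (l2normD _ _)).
by apply: lerD; exact: le_opnorm.
Qed.

Lemma opnormM (m n p : nat) (A : 'M[C]_(m, n)) (B : 'M[C]_(n, p)) :
  opnorm (A *m B) <= opnorm A * opnorm B.
Proof.
apply: opnorm_le => [|x]; first by rewrite mulr_ge0 ?opnorm_ge0.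
rewrite -mulmxA -mulrA; apply: (le_trans (le_opnorm _ _)).
by rewrite ler_wpM2l ?opnorm_ge0 ?le_opnorm.
Qed.

(** With A' the adjoint, |A' x| ^ 2 = <x, A A' x> <= |x| |A| |A' x|. *)
Lemma opnorm_adjmx (m n : nat) (A : 'M[C]_(m, n)) : opnorm (A^t*) <= opnorm A.
Proof.
apply: opnorm_le => [|x]; first exact: opnorm_ge0.
have [Ax0|Ax0] := leP (l2norm (A^t* *m x)) 0.
  by rewrite (l2norm0_eq0 Ax0) l2norm0 mulr_ge0 ?opnorm_ge0 ?l2norm_ge0.
rewrite -(ler_pM2r Ax0) -expr2.
have : (l2norm (A^t* *m x) ^+ 2)%:C
       <= (l2norm x * l2norm (A *m (A^t* *m x)))%:C.
  apply: le_trans (l2norm_CauchySchwarz _ _).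
  rewrite l2norm_sqrE adjmxM trmxCK -mulmxA ger0_norm//.
  by rewrite mulmxA -{1}(trmxCK A) -adjmxM -l2norm_sqrE ler0c sqr_ge0.
rewrite lecR => /le_trans; apply.
rewrite mulrAC mulrC ler_wpM2r ?l2norm_ge0//.
exact: le_opnorm.
Qed.

End OperatorNorm.

(** * Spectral decomposition and square roots *)

Section SpectralCalculus.
Context {R : realType}.
Local Notation C := R[i].

Definition rdiag (n : nat) (d : 'I_n -> R) : 'M[C]_n :=
  diag_mx (\row_i (d i)%:C).

(** With U unitary, these are the functions of a Hermitian matrix that has the
    rows of U as left eigenvectors; products act on d ([udiagM]). *)
Definition udiag (n : nat) (U : 'M[C]_n) (d : 'I_n -> R) : 'M[C]_n :=
  U^t* *m rdiag d *m U.

(** The rows of the unitary matrix of the spectral theorem are nonzero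
    left eigenvectors, so every diagonal entry is an eigenvalue. *)
Lemma hermitian_udiag (n : nat) (A : 'M[C]_n) (S : set R) :
  A \is hermsymmx -> spectrum_in A S ->
  exists U d, [/\ U \is unitarymx, forall i, S (d i) & A = udiag U d].
Proof.
move=> Ah AS.
have [U [e [Uu AE]]] : exists (U : 'M[C]_n) (e : 'rV[C]_n),
    U \is unitarymx /\ A = U^t* *m diag_mx e *m U.
  exists (spectralmx A), (spectral_diag A); split.
    exact: spectral_unitarymx.
  rewrite -(invmx_unitary (spectral_unitarymx A)).
  exact/orthomx_spectralP/hermitian_normalmx.
have eS i : exists s, S s /\ e 0 i = s%:C.
  suff /AS[s Ss es] : eigenvalue A (e 0 i) by exists s.
  apply/eigenvalueP; exists (row i U).
    rewrite AE !mulmxA -row_mul (unitarymxP Uu).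
    by rewrite row1 -rowE row_diag_mx -scalemxAl -rowE.
  apply/eqP => U0; have /row_unitarymxP/(_ i i)/eqP := Uu.
  by rewrite U0 eqxx linear0l eq_sym oner_eq0.
have [d dP] := choice eS.
have eE : e = \row_i (d i)%:C by apply/rowP => i; rewrite mxE; case: (dP i).
exists U, d; split; first exact: Uu.
  by move=> i; case: (dP i).
by rewrite /udiag /rdiag -eE.
Qed.

Lemma udiagM (n : nat) (U : 'M[C]_n) (d e : 'I_n -> R) : U \is unitarymx ->
  udiag U d *m udiag U e = udiag U (fun i => d i * e i).
Proof.
move=> /unitarymxP UV; rewrite /udiag /rdiag; move: (U^t*) UV => V UV.
rewrite !mulmxA -(mulmxA _ U V) UV mulmx1 -(mulmxA V (diag_mx _)) mulmx_diag.
set v := \row_i _; suff -> : v = \row_i (d i * e i)%:C by [].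
by apply/rowP => i; rewrite !mxE rmorphM.
Qed.

Lemma udiag_herm (n : nat) (U : 'M[C]_n) (d : 'I_n -> R) :
  udiag U d \is hermsymmx.
Proof.
apply/hermsymP; rewrite /udiag !adjmxM trmxCK mulmxA /rdiag.
rewrite tr_diag_mx map_diag_mx; congr (_ *m diag_mx _ *m _).
by apply/rowP => i; rewrite !mxE; exact: conj_realc.
Qed.

Lemma qform_udiag (n : nat) (U : 'M[C]_n) (d : 'I_n -> R) (x : 'cV[C]_n) :
  qform (udiag U d) x = (\sum_i d i * Normc.normc ((U *m x) i 0) ^+ 2)%:C.
Proof.
rewrite /qform /udiag !mulmxA -adjmxM -mulmxA mxE rmorph_sum.
apply: eq_bigr => i _; rewrite /rdiag mul_mx_diag rmorphM /= sqr_normcE.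
by move: (U *m x) => y; rewrite !mxE; ring.
Qed.

Lemma l2norm_unitary (n : nat) (U : 'M[C]_n) (x : 'cV[C]_n) :
  U \is unitarymx -> l2norm (U *m x) = l2norm x.
Proof.
move=> Uu; apply/eqP; rewrite -(@eqrXn2 _ 2)// ?l2norm_ge0//.
apply/eqP/complexI; rewrite !l2norm_sqrE adjmxM mulmxA.
rewrite -(mulmxA _ (U^t*)) -(invmx_unitary Uu).
by rewrite (mulVmx (unitarymx_unit Uu)) mulmx1.
Qed.

Lemma qform_udiag_ge (n : nat) (U : 'M[C]_n) (d : 'I_n -> R) (m : R) x :
  U \is unitarymx -> (forall i, m <= d i) ->
  (m * l2norm x ^+ 2)%:C <= qform (udiag U d) x.
Proof.
move=> Uu md; rewrite qform_udiag lecR -(l2norm_unitary _ Uu) l2norm_sqr.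
by rewrite mulr_sumr; apply: ler_sum => i _; rewrite ler_wpM2r ?sqr_ge0.
Qed.

Lemma qform_udiag_le (n : nat) (U : 'M[C]_n) (d : 'I_n -> R) (m : R) x :
  U \is unitarymx -> (forall i, d i <= m) ->
  qform (udiag U d) x <= (m * l2norm x ^+ 2)%:C.
Proof.
move=> Uu md; rewrite qform_udiag lecR -(l2norm_unitary _ Uu) l2norm_sqr.
by rewrite mulr_sumr; apply: ler_sum => i _; rewrite ler_wpM2r ?sqr_ge0.
Qed.

Lemma udiag_pd (n : nat) (U : 'M[C]_n) (d : 'I_n -> R) :
  U \is unitarymx -> (forall i, 0 < d i) -> pdmx (udiag U d).
Proof.
move=> Uu d0; split; first exact: udiag_herm.
move=> x x0; rewrite qform_udiag ltcR lt_neqAle eq_sym.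
have T_ge0 i : 0 <= d i * Normc.normc ((U *m x) i 0) ^+ 2.
  by rewrite mulr_ge0 ?sqr_ge0// ltW.
rewrite sumr_ge0// andbT; apply: contra_neqN x0 => /eqP/psumr_eq0P T0.
apply: l2norm0_eq0; rewrite -(l2norm_unitary _ Uu).
suff -> : U *m x = 0 by rewrite l2norm0.
apply/colP => i; rewrite [RHS]mxE; apply: Normc.eq0_normc; apply/eqP.
have /eqP := T0 (fun i _ => T_ge0 i) i isT.
by rewrite mulf_eq0 gt_eqF//= sqrf_eq0.
Qed.

(** The definition picks a square root if there is one; taking square roots of
    the eigenvalues shows that there is. *)
Lemma sqrtmxP (n : nat) (A : 'M[C]_n) (S : set R) :
  A \is hermsymmx -> spectrum_in A S -> S `<=` [set s | 0 < s] ->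
  pdmx (sqrtmx A) /\ sqrtmx A *m sqrtmx A = A.
Proof.
move=> Ah AS S0; have [U [d [Uu dS AE]]] := hermitian_udiag Ah AS.
have d0 i : 0 < d i by exact/S0/dS.
rewrite /sqrtmx; apply: (@xgetPex _ 0 [set B : 'M[C]_n | pdmx B /\ B *m B = A]).
exists (udiag U (fun i => Num.sqrt (d i))); split.
  by apply: udiag_pd => // i; rewrite sqrtr_gt0.
rewrite (udiagM _ _ Uu) AE; congr udiag; apply/funext => i.
by rewrite -expr2 sqr_sqrtr// ltW.
Qed.

Lemma spectrum_qform_ge (n : nat) (A : 'M[C]_n) (S : set R) (m : R) x :
  A \is hermsymmx -> spectrum_in A S -> (forall s, S s -> m <= s) ->
  (m * l2norm x ^+ 2)%:C <= qform A x.
Proof.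
move=> Ah AS Sm; have [U [d [Uu dS ->]]] := hermitian_udiag Ah AS.
by apply: qform_udiag_ge => // i; exact/Sm/dS.
Qed.

Lemma spectrum_qform_le (n : nat) (A : 'M[C]_n) (S : set R) (m : R) x :
  A \is hermsymmx -> spectrum_in A S -> (forall s, S s -> s <= m) ->
  qform A x <= (m * l2norm x ^+ 2)%:C.
Proof.
move=> Ah AS Sm; have [U [d [Uu dS ->]]] := hermitian_udiag Ah AS.
by apply: qform_udiag_le => // i; exact/Sm/dS.
Qed.

End SpectralCalculus.

(** * Bounds on a square root *)

Section SquareRootBounds.
Context {R : realType}.
Local Notation C := R[i].

Lemma qform_sqr (n : nat) (P : 'M[C]_n) (x : 'cV[C]_n) : P \is hermsymmx ->
  qform (P *m P) x = (l2norm (P *m x) ^+ 2)%:C.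
Proof.
move=> /hermsymP Ph; rewrite l2norm_sqrE adjmxM Ph /qform.
by rewrite !mulmxA.
Qed.

Lemma opnorm_sqrt_le (n : nat) (P : 'M[C]_n) (s : R) : P \is hermsymmx ->
  0 <= s -> (forall x, qform (P *m P) x <= (s * l2norm x ^+ 2)%:C) ->
  opnorm P <= Num.sqrt s.
Proof.
move=> Ph s0 Ps; apply: opnorm_le => [|x]; first exact: sqrtr_ge0.
rewrite -(@ler_pXn2r _ 2)// ?nnegrE ?mulr_ge0 ?l2norm_ge0 ?sqrtr_ge0//.
by rewrite exprMn (sqr_sqrtr s0) -lecR -qform_sqr.
Qed.

(** The cross term 2 t <P x, x> in the square of the right-hand side is
    nonnegative, so shifting P by t >= 0 cannot bring vectors closer to 0. *)
Lemma l2norm_shift_ge (n : nat) (P : 'M[C]_n) (m t : R) (x : 'cV[C]_n) :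
  pdmx P -> 0 <= m -> 0 <= t ->
  (forall x, (m * l2norm x ^+ 2)%:C <= qform (P *m P) x) ->
  Num.sqrt m * l2norm x <= l2norm (P *m x + t%:C *: x).
Proof.
move=> [Ph P0] m0 t0 Pm.
rewrite -(@ler_pXn2r _ 2)// ?nnegrE ?mulr_ge0 ?l2norm_ge0 ?sqrtr_ge0//.
rewrite exprMn (sqr_sqrtr m0) -lecR; apply: (le_trans (Pm x)).
have Px_ge0 : 0 <= qform P x.
  have [->|x0] := eqVneq x 0; first by rewrite /qform mulmx0 mxE.
  exact/ltW/P0.
have -> : (l2norm (P *m x + t%:C *: x) ^+ 2)%:C =
    qform (P *m P) x + (t%:C * qform P x *+ 2 + t%:C ^+ 2 * (l2norm x ^+ 2)%:C).
  rewrite !l2norm_sqrE.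
  move/hermsymP: Ph => Ph.
  rewrite adjmxD adjmxZ conj_realc adjmxM Ph.
  rewrite /qform !mulmxDl !mulmxDr -!scalemxAl -!scalemxAr scalerA !mulmxA.
  set X := x^t* *m P *m x; set Y := x^t* *m P *m P *m x.
  by move: X Y (x^t* *m x) => {}X {}Y Z; rewrite !mxE; ring.
rewrite lerDl; apply: addr_ge0.
  by apply: mulrn_wge0; rewrite mulr_ge0 ?ler0c.
by rewrite mulr_ge0 ?exprn_ge0 ?ler0c ?sqr_ge0.
Qed.

End SquareRootBounds.

(** * The Sylvester equation with a block scalar coefficient *)

Section Sylvester.
Context {R : realType}.
Local Notation C := R[i].

(** On each of the two coordinate blocks the coefficient on the right is a
    scalar v, so that X w solves (P + v) (X w) = Y w.  The factor 2 comes from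
    adding the two blocks by the triangle inequality. *)
Lemma opnorm_sylvester (p q n : nat) (P : 'M[C]_n) (X Y : 'M[C]_(n, p + q))
    (c t u : R) :
  0 < c -> 0 <= t -> 0 <= u ->
  (forall v x, 0 <= v -> c * l2norm x <= l2norm (P *m x + v%:C *: x)) ->
  P *m X + X *m block_mx (t%:C)%:M 0 0 (u%:C)%:M = Y ->
  opnorm X <= 2 / c * opnorm Y.
Proof.
move=> c0 t0 u0 Pc XY.
have Hk v w : 0 <= v ->
    block_mx (t%:C)%:M 0 0 (u%:C)%:M *m w = v%:C *: w ->
    l2norm (X *m w) <= c^-1 * (opnorm Y * l2norm w).
  move=> v0 wv; rewrite ler_pdivlMl//; apply: (le_trans (Pc _ _ v0)).
  apply: le_trans (le_opnorm _ _); rewrite -XY mulmxDl -!mulmxA wv.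
  by rewrite -scalemxAr.
apply: opnorm_le => [|x].
  by rewrite mulr_ge0 ?opnorm_ge0// divr_ge0// ltW.
have xE : x = col_mx (usubmx x) 0 + col_mx 0 (dsubmx x).
  by rewrite add_col_mx addr0 add0r vsubmxK.
rewrite {1}xE mulmxDr; apply: (le_trans (l2normD _ _)).
have -> : 2 / c * opnorm Y * l2norm x =
    c^-1 * (opnorm Y * l2norm x) + c^-1 * (opnorm Y * l2norm x) by ring.
have c1 : 0 <= c^-1 by rewrite invr_ge0 ltW.
apply: lerD.
  apply: (le_trans (Hk t _ t0 _)).
    rewrite mul_block_col !mul0mx !mulmx0 !addr0.
    by rewrite mul_scalar_mx scale_col_mx scaler0.
  by rewrite !ler_wpM2l ?opnorm_ge0 ?l2norm_usub.
apply: (le_trans (Hk u _ u0 _)).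
  rewrite mul_block_col !mul0mx !mulmx0 !add0r.
  by rewrite mul_scalar_mx scale_col_mx scaler0.
by rewrite !ler_wpM2l ?opnorm_ge0 ?l2norm_dsub.
Qed.

(** If P and Q are two square roots of the same matrix, then
    P (P - Q) + (P - Q) Q = 0. *)
Lemma pd_sqrt_block_scalar (p q : nat) (P : 'M[C]_(p + q)) (m a b : R) :
  pdmx P -> 0 < m -> 0 <= a -> 0 <= b ->
  (forall x, (m * l2norm x ^+ 2)%:C <= qform (P *m P) x) ->
  P *m P = block_mx (a%:C)%:M 0 0 (b%:C)%:M ->
  P = block_mx ((Num.sqrt a)%:C)%:M 0 0 ((Num.sqrt b)%:C)%:M.
Proof.
move=> Ppd m0 a0 b0 Pm PP; set Q := block_mx _ _ _ _.
have QQ : Q *m Q = P *m P.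
  rewrite PP mulmx_block !mulmx0 !mul0mx !addr0 !add0r -!scalar_mxM -!rmorphM.
  by rewrite -!expr2 !sqr_sqrtr.
apply/eqP; rewrite -subr_eq0; apply/eqP/opnorm_le0.
rewrite -(mulr0 (2 / Num.sqrt m)) -(opnorm0 (p + q) (p + q)).
apply: (@opnorm_sylvester _ _ _ P _ _ _ (Num.sqrt a) (Num.sqrt b)).
- by rewrite sqrtr_gt0.
- exact: sqrtr_ge0.
- exact: sqrtr_ge0.
- by move=> v x v0; apply: l2norm_shift_ge => //; exact: ltW.
- by rewrite -/Q mulmxBl mulmxBr QQ addrA subrK subrr.
Qed.

(** The difference D = P - Q solves P D + D Q = P P - Q Q, and Q K is K times
    the swapped block scalar matrix; hence D K solves a Sylvester equation
    with right-hand side (P P - Q Q) K. *)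
Lemma opnorm_sandwich_diff (r : nat) (P Q K : 'M[C]_(r + r)) (Theta : 'M[C]_r)
    (c s t u : R) :
  P \is hermsymmx -> K \is hermsymmx ->
  0 < c -> 0 <= t -> 0 <= u ->
  (forall v x, 0 <= v -> c * l2norm x <= l2norm (P *m x + v%:C *: x)) ->
  opnorm P <= s -> opnorm Q <= s ->
  Q = block_mx (t%:C)%:M 0 0 (u%:C)%:M -> K = block_mx 0 Theta Theta 0 ->
  opnorm (P *m K *m P - Q *m K *m Q)
    <= 4 * s / c * opnorm ((P *m P - Q *m Q) *m K).
Proof.
move=> Ph Kh c0 t0 u0 Pc Ps Qs QE KE.
have Qh : Q \is hermsymmx.
  apply/hermsymP; rewrite QE tr_block_mx map_block_mx !tr_scalar_mx !trmx0.
  by rewrite !map_mx0 !map_scalar_mx /= !conj_realc.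
have DKs : opnorm ((P - Q) *m K) <= 2 / c * opnorm ((P *m P - Q *m Q) *m K).
  (* Moving Q across K exchanges the two scalars. *)
  apply: (@opnorm_sylvester _ _ _ P _ _ _ u t) => //.
  have -> : (P - Q) *m K *m block_mx (u%:C)%:M 0 0 (t%:C)%:M
      = (P - Q) *m (Q *m K).
    rewrite -mulmxA; congr (_ *m _).
    rewrite QE KE !mulmx_block !mulmx0 !mul0mx !addr0 !add0r.
    by rewrite !mul_mx_scalar !mul_scalar_mx.
  by rewrite !mulmxBl !mulmxBr !mulmxA subrKA.
have KDs : opnorm (K *m (P - Q)) <= opnorm ((P - Q) *m K).
  suff -> : K *m (P - Q) = ((P - Q) *m K)^t* by exact: opnorm_adjmx.
  by rewrite adjmxM adjmxB (hermsymP _ Kh) (hermsymP _ Ph) (hermsymP _ Qh).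
have -> : P *m K *m P - Q *m K *m Q
    = (P - Q) *m K *m P + Q *m (K *m (P - Q)).
  by rewrite !mulmxBl !mulmxBr !mulmxA subrKA.
apply: (le_trans (opnormD _ _)).
have -> : 4 * s / c * opnorm ((P *m P - Q *m Q) *m K) =
    2 / c * opnorm ((P *m P - Q *m Q) *m K) * s
    + s * (2 / c * opnorm ((P *m P - Q *m Q) *m K)) by ring.
apply: lerD; apply: (le_trans (opnormM _ _)).
  exact: ler_pM (opnorm_ge0 _) (opnorm_ge0 _) DKs Ps.
exact: ler_pM (opnorm_ge0 _) (opnorm_ge0 _) Qs (le_trans KDs DKs).
Qed.

End Sylvester.

(** * The estimate *)

Lemma compact_pos_bounds (R : realType) (S : set R) :
  compact S -> S `<=` [set s : R | 0 < s] ->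
  exists m s : R,
    [/\ 0 < m, 0 < s, forall x, S x -> m <= x & forall x, S x -> x <= s].
Proof.
move=> cS S0; have [->|/set0P Sne] := eqVneq S set0.
  by exists 1, 1; split.
have id_cont : {within S, continuous (@id R)}.
  by apply: continuous_subspaceT => x.
have [m /set_mem Sm mS] := compact_EVT_min Sne cS id_cont.
have [s /set_mem Ss sS] := compact_EVT_max Sne cS id_cont.
exists m, s; split; [exact: S0|exact: S0|move=> x Sx..].
  exact/mS/mem_set.
exact/sS/mem_set.
Qed.

Theorem lemma4p4 (R : realType) (S : set R) :
  compact S -> S `<=` [set s : R | 0 < s] ->
  exists C : R,
    forall (r : nat) (G M : 'M[R[i]]_(r + r)) (a b : R) (Theta : 'M[R[i]]_r),
      pdmx G -> pdmx M ->
      spectrum_in G S -> spectrum_in M S ->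
      0 < a -> 0 < b ->
      M = block_mx (a%:C)%:M 0 0 (b%:C)%:M ->
      is_diag_mx Theta -> psdmx Theta ->
      let K : 'M[R[i]]_(r + r) := block_mx 0 Theta Theta 0 in
      opnorm (sqrtmx G *m K *m sqrtmx G - sqrtmx M *m K *m sqrtmx M)
        <= C * (opnorm ((G - M) *m K) + opnorm (K *m (G - M))).
Proof.
move=> cS S0; have [m [s [m0 s0 mS sS]]] := compact_pos_bounds cS S0.
exists (4 * Num.sqrt s / Num.sqrt m).
move=> r G M a b Theta [Gh _] [Mh _] GS MS a0 b0 ME _ [Thetah _].
cbv zeta; set K := block_mx 0 Theta Theta 0.
have [Ppd PP] := sqrtmxP Gh GS S0; have [Qpd QQ] := sqrtmxP Mh MS S0.
have Kh : K \is hermsymmx.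
  apply/hermsymP; rewrite /K tr_block_mx map_block_mx !trmx0 !map_mx0.
  by rewrite (hermsymP _ Thetah).
have QE : sqrtmx M = block_mx ((Num.sqrt a)%:C)%:M 0 0 ((Num.sqrt b)%:C)%:M.
  apply: (pd_sqrt_block_scalar Qpd m0 (ltW a0) (ltW b0)) => [x|].
    by rewrite QQ; exact: spectrum_qform_ge Mh MS mS.
  by rewrite QQ.
have sqrt_le (A : 'M_(r + r)) :
    A \is hermsymmx -> spectrum_in A S -> pdmx (sqrtmx A) ->
    sqrtmx A *m sqrtmx A = A -> opnorm (sqrtmx A) <= Num.sqrt s.
  move=> Ah AS [Bh _] BB; apply: opnorm_sqrt_le => // [|x]; first exact: ltW.
  by rewrite BB; exact: spectrum_qform_le Ah AS sS.
have Pshift v x : 0 <= v ->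
    Num.sqrt m * l2norm x <= l2norm (sqrtmx G *m x + v%:C *: x).
  move=> v0; apply: (l2norm_shift_ge x Ppd (ltW m0) v0) => y.
  by rewrite PP; exact: spectrum_qform_ge Gh GS mS.
have m1 : 0 < Num.sqrt m by rewrite sqrtr_gt0.
have := opnorm_sandwich_diff Ppd.1 Kh m1 (sqrtr_ge0 a) (sqrtr_ge0 b) Pshift
  (sqrt_le _ Gh GS Ppd PP) (sqrt_le _ Mh MS Qpd QQ) QE erefl.
rewrite PP QQ => PKP; apply: (le_trans PKP).
rewrite ler_wpM2l ?lerDl ?opnorm_ge0//.
by rewrite divr_ge0 ?mulr_ge0 ?sqrtr_ge0.
Qed.
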